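(* Let $p$ be a prime number and let $\underline{R}=M(K_{2p+1})$ be the graphic matroid associated to the complete graph $K_{2p+1}$ on $2p+1$ vertices, with edge set $S$. Then any $\mathbb{F}_p$-solution $b=(b_s)_{s\in S}$ of $\underline{R}$ in the mod $p$ Albanese graph $\mathrm{Alb}_p(\underline{R})$ has trivial color profile $\lambda(b)=0\in\mathbb{F}_p^S$.
   Context: Let $G$ be a finite graph with vertex set $V$ and edge set $S$, and fix an orientation of each edge. Let $(e_s)_{s\in S}$ be the standard basis of $\mathbb{F}_p^S=C^1(G,\mathbb{F}_p)$. For the graphic matroid $\underline{R}=M(G)$ put $U_{\mathbb{F}_p}=B^1(G,\mathbb{F}_p)\subset\mathbb{F}_p^S$, the span of the coboundaries $\delta_v=\sum_{s\text{ ending at }v}e_s-\sum_{s\text{ starting at }v}e_s$, $v\in V$, and $W=\mathbb{F}_p^S/U_{\mathbb{F}_p}=H^1(G,\mathbb{F}_p)$. The image of $e_s$ in $W$ is again denoted $e_s$. The mod $p$ Albanese graph $\mathrm{Alb}_p(\underline{R})$ is the oriented, $S$-colored graph with vertex set $W$ that has, for each $w\in W$ and $s\in S$, one positively oriented edge $[w\to w+e_s]$ of color $s$ (the Cayley graph of $W$ with respect to the generators $e_s$). $C_1(\mathrm{Alb}_p(\underline{R}),\mathbb{F}_p)$ is the $\mathbb{F}_p$-vector space of 1-chains, with basis the positively oriented edges, and $\partial[w\to w+e_s]=[w+e_s]-[w]$. A 1-chain of color $s$ is a linear combination of edges of color $s$. An $\mathbb{F}_p$-solution of $\underline{R}$ in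 $\mathrm{Alb}_p(\underline{R})$ is a collection $b=(b_s)_{s\in S}$ of 1-chains $b_s\in C_1(\mathrm{Alb}_p(\underline{R}),\mathbb{F}_p)$ of color $s$ such that, whenever $c_s\in\mathbb{F}_p$ satisfy $\sum_{s\in S}c_se_s\in U_{\mathbb{F}_p}\subset\mathbb{F}_p^S$, one has $\partial\sum_{s\in S}c_sb_s=0$. For such $b_s$, $\lambda_s(b_s)\in\mathbb{F}_p$ is the sum of the coefficients of $b_s$ when written as a linear combination of positively oriented edges of color $s$; the color profile of $b$ is $\lambda(b)=(\lambda_s(b_s))_{s\in S}\in\mathbb{F}_p^S$. *)

(* Defs.v *)
From HB Require Import structures.
From mathcomp Require Import all_boot all_order all_algebra.

Set Implicit Arguments.
Unset Strict Implicit.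
Unset Printing Implicit Defensive.
Import GRing.Theory.
Local Open Scope ring_scope.
Local Open Scope quotient_scope.

Record orgraph := OrGraph {
  vert : finType;
  edge : finType;
  source : edge -> vert;
  target : edge -> vert }.

(* The edges of K_n are the 2-element subsets of its vertex set 'I_n. *)
Definition K_edge (n : nat) : finType := {e : {set 'I_n} | #|e| == 2%N}.

Definition is_K_orientation (n : nat) (src tgt : K_edge n -> 'I_n) : Prop :=
  forall s : K_edge n, val s = [set src s; tgt s].

Definition oriented_K (n : nat) (src tgt : K_edge n -> 'I_n) : orgraph :=
  @OrGraph 'I_n (K_edge n) src tgt.

Section Albanese.

(* The definitions make sense for every p, but 'F_p is the field with p
   elements only when p is prime. *)
Variables (p : nat) (G : orgraph).
Local Notation V := (vert G).
Local Notation S := (edge G).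

(* The regular module ('F_p)^o, rather than 'F_p, is what gives these function
   spaces their vector space structure. *)
Local Notation cochain1 := {ffun S -> ('F_p)^o}.

Definition std_basis (s : S) : cochain1 := [ffun t => (t == s)%:R].

Definition coboundary (v : V) : cochain1 :=
  \sum_(s : S | target s == v) std_basis s
  - \sum_(s : S | source s == v) std_basis s.

Definition B1 : {vspace cochain1} := <<[seq coboundary v | v : V]>>%VS.

(* W = C^1 / B^1 is used only through its (finite) additive group. *)
Definition H1 := Quotient.quot (pred_of_vspace B1).
HB.instance Definition _ := ZmodQuotient.on H1.
HB.instance Definition _ : isCountable H1 := CanIsCountable (@reprK _ H1).
HB.instance Definition _ : isFinite H1 := CanIsFinite (@reprK _ H1).

Definition e_ (s : S) : H1 := \pi_H1 (std_basis s).

(* The pair (w, s) stands for the positively oriented edge [w -> w + e_s] of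
   color s. *)
Definition alb_edge := (H1 * S)%type.

Definition chain0 := {ffun H1 -> ('F_p)^o}.
Definition chain1 := {ffun alb_edge -> ('F_p)^o}.

Definition vertex0 (w : H1) : chain0 := [ffun x => (x == w)%:R].

Definition boundary (b : chain1) : chain0 :=
  \sum_(a : alb_edge) b a *: (vertex0 (a.1 + e_ a.2) - vertex0 a.1).

Definition has_color (s : S) (b : chain1) : Prop :=
  forall a : alb_edge, a.2 != s -> b a = 0.

Definition is_solution (b : S -> chain1) : Prop :=
  (forall s, has_color s (b s)) /\
  (forall c : S -> 'F_p,
     \sum_(s : S) c s *: std_basis s \in B1 ->
     boundary (\sum_(s : S) c s *: b s) = 0).

Definition color_sum (s : S) (b : chain1) : 'F_p := \sum_(w : H1) b (w, s).

Definition color_profile (b : S -> chain1) : cochain1 :=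
  [ffun s => color_sum s (b s)].

End Albanese.

(* Main.v *)
Require Import Defs.
From mathcomp Require Import all_boot all_order all_algebra.
From mathcomp Require Import ring zify.

(** Let [f v], for [v] a vertex, be functions [W -> F_p] such that for every
    edge [s] the difference [f (target s) - f (source s)] changes by a constant
    [k s] under translation by [e_s].  Pairing [f v] with the relation
    [\partial \sum_s (\delta_v)_s b_s = 0] and summing over [v] gives
    [\sum_s k s * lambda_s = 0].  So it suffices to find, for a given edge
    [o -> q] of [K_(2p+1)], such functions with [k] the indicator of that edge.

    Write [T] for the remaining [2p - 1] vertices, [x_j] for the integral of a
    cochain along the closed walk [o q j o], [t_ij] for that along [o q i j o],
    and [x_K] for the product of the [x_j] with [j] in [K].  One takes [f o = 0],
    [f q = e_p(x)] and, for [i] in [T],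
      [f i = \sum_K x_K * (if i = r(K) then - \sum_j t_ij else t_(i, r(K)))],
    where [K] runs over the [(p-1)]-subsets of [T] avoiding [i], [r(K)] is a
    chosen element of [T \ K], and [j] runs over [T \ K] minus [i].
    - The edge [o i] occurs in no term of [f i].
    - Along [q i], [x_i] and all [t_ij] change alike; as [-(p - 1) = 1], both
      [f i] and [f q] change by a multiple of [e_(p-1)] of the [x_j], [j <> i].
    - Along [i j], [t_ij] and [t_ji] change oppositely, and [f i] and [f j]
      change by the same sum of multiples of the [x_K] with [K] avoiding both.
    - Along [o q], all [x_j] increase by 1, and [e_p(x + 1) = e_p(x) + 1]. *)

Set Implicit Arguments.
Unset Strict Implicit.
Unset Printing Implicit Defensive.
Import GRing.Theory.
Local Open Scope ring_scope.

(** * Elementary symmetric polynomials *)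

Section ElementarySymmetric.

Variables (V : finType) (R : comNzRingType).
Implicit Types (T I J K : {set V}) (x : V -> R).

Definition elsym T k x : R :=
  \sum_(J : {set V} | (J \subset T) && (#|J| == k)) \prod_(j in J) x j.

Lemma eq_elsym T k x y : {in T, x =1 y} -> elsym T k x = elsym T k y.
Proof.
move=> eqxy; apply: eq_bigr => J /andP[/subsetP JT _].
by apply: eq_bigr => j /JT /eqxy.
Qed.

Lemma elsymS T k x i : i \in T ->
  elsym T k.+1 x = x i * elsym (T :\ i) k x + elsym (T :\ i) k.+1 x.
Proof.
move=> iT; rewrite /elsym (bigID (fun J => i \in J)) /=; congr (_ + _); last first.
  by apply: eq_bigl => J; rewrite subsetD1 andbAC.
rewrite (reindex_onto (fun K => i |: K) (fun J => J :\ i)) /=; last first.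
  by move=> J /andP[_ iJ]; rewrite setD1K.
rewrite big_distrr /=; apply: eq_big => [K|K /andP[_ /eqP eqK]].
  have [iK|iNK] := boolP (i \in K).
    rewrite subsetD1 iK andbF /= andbC; case: eqP => //= eqK.
    by move: iK; rewrite -eqK !inE eqxx.
  rewrite setU1K // eqxx andbT subsetD1 iNK andbT setU11 andbT cardsU1 iNK eqSS.
  by rewrite subUset sub1set iT.
have iNK : i \notin K by rewrite -eqK !inE eqxx.
by rewrite big_setU1.
Qed.

Lemma prod_add1 J x :
  \prod_(j in J) (x j + 1) = \sum_(I : {set V} | I \subset J) \prod_(j in I) x j.
Proof.
(* Indices outside [J] get the factor 0 + 1, so the product runs over all of [V] and expands over
   all subsets; those not inside [J] contribute 0. *)
transitivity (\prod_j ((if j \in J then x j else 0) + 1)).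
  by rewrite big_mkcond; apply: eq_bigr => j _; case: ifP; rewrite ?add0r.
rewrite bigA_distr [RHS]big_mkcond; apply: eq_bigr => I _ /=.
rewrite -big_mkcond /=; case: ifP => [/subsetP IJ|/negbT/subsetPn[j jI jNJ]].
  by apply: eq_bigr => j /IJ ->.
by rewrite (bigD1 j) //= (negbTE jNJ) mul0r.
Qed.

(** Adjoining [I] is a bijection from the subsets of [T :\: I] of size [k - #|I|]. *)
Lemma card_supersets T I k : I \subset T -> (#|I| <= k)%N ->
  #|[set J : {set V} | (I \subset J) && (J \subset T) && (#|J| == k)]|
    = 'C(#|T| - #|I|, k - #|I|).
Proof.
move=> IT Ik; rewrite -(cardsDS IT) -cards_draws.
have injU : {in [set L : {set V} | L \subset T :\: I & #|L| == k - #|I|]%N &,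
    injective (fun L : {set V} => I :|: L)}.
  have UK (L : {set V}) : L \subset T :\: I -> (I :|: L) :\: I = L.
    rewrite subsetD => /andP[_ /disjoint_setI0 dLI].
    by rewrite setDUl setDv set0U; apply/setDidPl; rewrite -setI_eq0 dLI.
  move=> L M; rewrite !inE => /andP[LT _] /andP[MT _] eqU.
  by rewrite -(UK L) // -(UK M) // eqU.
rewrite -(card_in_imset injU); apply: eq_card => J; rewrite inE.
apply/andP/imsetP => [[/andP[IJ JT] /eqP cJ]|[L]].
  exists (J :\: I); first by rewrite inE setSD //= cardsDS // cJ.
  by rewrite -{1}(setID J I) (setIidPr IJ).
rewrite inE subsetD => /andP[/andP[LT dLI] /eqP cL] ->.
rewrite subsetUl subUset IT LT; split=> //.
by rewrite cardsU setIC (disjoint_setI0 dLI) cards0 subn0 cL subnKC.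
Qed.

Lemma sum_delta (f : V -> R) y : \sum_x f x * (x == y)%:R = f y.
Proof.
by rewrite (bigD1 y) //= eqxx mulr1 big1 ?addr0 // => x /negbTE->; rewrite mulr0.
Qed.

End ElementarySymmetric.

(** * Binomial coefficients modulo p and the shift of e_p *)

Lemma dvdn_bin_pred p k : prime p -> (0 < k < p)%N ->
  (p %| 'C(2 * p - 1 - k, p - k))%N.
Proof.
move=> pp /andP[k0 kp]; have -> : (2 * p - 1 - k = p + (p - 1 - k))%N.
  by rewrite mul2n -addnn -!subnDA addnBA //; lia.
(* The term j = 0 vanishes since p - k > p - 1 - k; in the others 0 < j < p because k > 0, so p
   divides 'C(p, j). *)
rewrite -binomial.Vandermonde; apply: dvdn_sum => -[j /= jlt] _.
have [->|j0] := posnP j; first by rewrite [X in (_ * X)%N]bin_small ?muln0 //; lia.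
apply: dvdn_mulr; apply: prime_dvd_bin => //; lia.
Qed.

Lemma dvdn_bin_sub1 p : prime p -> (p %| 'C(2 * p - 1, p) - 1)%N.
Proof.
move=> pp; have p0 := prime_gt0 pp.
have -> : (2 * p - 1 = p + (p - 1))%N by lia.
(* The term j = p is the 1 being subtracted. *)
rewrite -binomial.Vandermonde big_ord_recr /= subnn binn bin0 addnK.
apply: dvdn_sum => -[j /= jp] _; have [->|j0] := posnP j.
  by rewrite [X in (_ * X)%N]bin_small ?muln0 //; lia.
by apply: dvdn_mulr; apply: prime_dvd_bin; rewrite ?j0.
Qed.

Section ModP.

Variables (p : nat) (V : finType) (R : comNzRingType).
Hypotheses (pp : prime p) (pR : p%:R = 0 :> R).

Lemma natr_dvdn m : (p %| m)%N -> m%:R = 0 :> R.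
Proof. by case/dvdnP => q ->; rewrite natrM pR mulr0. Qed.

(* This is where the size [2 * p - 1], hence the graph K_(2p+1), comes from:
   [e_k] occurs in [e_p(x + 1)] with coefficient ['C(2 * p - 1 - k, p - k)]. *)
Lemma elsym_add1 (T : {set V}) (x : V -> R) : #|T| = (2 * p - 1)%N ->
  elsym T p (fun j => x j + 1) = elsym T p x + 1.
Proof.
move=> cT; rewrite /elsym.
under eq_bigr do rewrite prod_add1.
rewrite (exchange_big_dep (fun I : {set V} =>
  (I \subset T) && (#|I| <= p)%N)) /=; last first.
  move=> J I /andP[JT /eqP <-] IJ.
  by rewrite (subset_trans IJ JT) subset_leq_card.
have coefE (I : {set V}) : (I \subset T) && (#|I| <= p)%N ->
    \sum_(J : {set V} | (J \subset T) && (#|J| == p) && (I \subset J))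
      \prod_(j in I) x j
    = 'C(2 * p - 1 - #|I|, p - #|I|)%:R * \prod_(j in I) x j.
  move=> /andP[IT Ip]; rewrite sumr_const -cT -(card_supersets IT Ip) mulr_natl.
  by congr (_ *+ _); apply: eq_card => J; rewrite !inE -andbA andbC.
rewrite (eq_bigr _ coefE) (bigID (fun I : {set V} => #|I| == p)) /=; congr (_ + _).
  apply: eq_big => [I|I /andP[_ /eqP ->]]; last by rewrite subnn bin0 mul1r.
  by rewrite -andbA; case: eqP => [->|]; rewrite ?leqnn ?andbF.
(* Below degree p only the constant term survives modulo p; its coefficient 'C(2p - 1, p) is 1. *)
rewrite (bigD1 set0) /= ?sub0set ?cards0 //=; last first.
  by rewrite eq_sym -lt0n prime_gt0.
rewrite big_set0 mulr1 !subn0 big1 ?addr0.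
  have p0 := prime_gt0 pp.
  have C0 : (0 < 'C(2 * p - 1, p))%N by rewrite bin_gt0; lia.
  by rewrite -(subnK C0) natrD natr_dvdn ?add0r // dvdn_bin_sub1.
move=> I /andP[/andP[/andP[IT Ip] cI] I0].
rewrite natr_dvdn ?mul0r // dvdn_bin_pred //.
by rewrite card_gt0 I0 ltn_neqAle cI.
Qed.

End ModP.

(** * The functions f v and their behaviour along each type of edge *)

Section Potential.

Variables (p : nat) (V : finType) (R : comNzRingType).
Hypotheses (pp : prime p) (pR : p%:R = 0 :> R) (cV : #|V| = (2 * p + 1)%N).
Variables (o q : V).
Hypothesis (oq : o != q).
Implicit Types (w : V -> V -> R) (i j v : V) (K : {set V}).

Let T : {set V} := ~: [set o; q].

Definition walk3 w j := w o q + w q j + w j o.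
Definition walk4 w i j := w o q + w q i + w i j + w j o.

(** This is r(K). The default [o] is not reached when [K] avoids some vertex of [T]. *)
Definition spare K := odflt o [pick j in T :\: K].

Definition potential w v : R :=
  if v == o then 0 else if v == q then elsym T p (walk3 w) else
  \sum_(K : {set V} | (K \subset T :\ v) && (#|K| == p.-1))
    (\prod_(j in K) walk3 w j) *
    (if v == spare K then - \sum_(j in T :\: K :\ v) walk4 w v j
     else walk4 w v (spare K)).

Lemma card_T : #|T| = (2 * p - 1)%N.
Proof. by have := cardsC [set o; q]; rewrite cards2 oq cV -/T; lia. Qed.

Lemma spareP K v : v \in T -> K \subset T :\ v -> #|K| = p.-1 ->
  (spare K \in T) && (spare K \notin K).
Proof.
move=> vT /subsetP KTv cK; rewrite /spare; case: pickP => [j|/(_ v)] /=.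
  by rewrite !inE andbC.
rewrite in_setD vT andbT; case: (boolP (v \in K)) => // /KTv.
by rewrite !inE eqxx.
Qed.

Lemma T_neq v : v \in T -> (v != o) * (v != q).
Proof. by rewrite !inE negb_or => /andP[]. Qed.

Lemma potentialT w v : v \in T -> potential w v =
  \sum_(K : {set V} | (K \subset T :\ v) && (#|K| == p.-1))
    (\prod_(j in K) walk3 w j) *
    (if v == spare K then - \sum_(j in T :\: K :\ v) walk4 w v j
     else walk4 w v (spare K)).
Proof. by move=> /T_neq vT; rewrite /potential !(negbTE vT.1, negbTE vT.2). Qed.

Lemma potential_o w : potential w o = 0.
Proof. by rewrite /potential eqxx. Qed.

Lemma potential_q w : potential w q = elsym T p (walk3 w).
Proof. by rewrite /potential eq_sym (negbTE oq) eqxx. Qed.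

(** At a vertex [v] of [T] the potential is linear in the [walk4 w v j], with coefficients that
    involve only the [walk3 w j] for [j] in [T :\ v]. *)
Lemma potential_change w w' v (c : V -> R) : v \in T ->
  {in T :\ v, walk3 w' =1 walk3 w} ->
  {in T :\ v, forall j, walk4 w' v j = walk4 w v j + c j} ->
  potential w' v = potential w v +
  \sum_(K : {set V} | (K \subset T :\ v) && (#|K| == p.-1))
    (\prod_(j in K) walk3 w j) *
    (if v == spare K then - \sum_(j in T :\: K :\ v) c j else c (spare K)).
Proof.
move=> vT eq3 eq4; rewrite !potentialT // -big_split /=.
apply: eq_bigr => K /andP[KT /eqP cK]; rewrite -mulrDr.
congr (_ * _); first by apply: eq_bigr => j /(subsetP KT) /eq3.
case: ifPn => [_|vK].
  rewrite -opprD -big_split /=; congr (- _); apply: eq_bigr => j.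
  by rewrite !inE => /and3P[jv _ jT]; apply: eq4; rewrite !inE jv.
by apply: eq4; rewrite in_setD1 eq_sym vK; case/andP: (spareP vT KT cK).
Qed.

(** Gradients integrate to 0 along closed walks. This lets the potential descend from cochains to
    classes in [H1]. *)
Lemma potential_gauge w w' (h : V -> R) v :
  (forall i j, w' i j = w i j + (h j - h i)) -> potential w' v = potential w v.
Proof.
move=> eqw; have eq3 : walk3 w' =1 walk3 w.
  by move=> j; rewrite /walk3 !eqw; ring.
have [->|vo] := eqVneq v o; first by rewrite !potential_o.
have [->|vq] := eqVneq v q; first by rewrite !potential_q; apply: eq_elsym.
have vT : v \in T by rewrite !inE negb_or vo vq.
rewrite (potential_change (w := w) (c := fun=> 0)) //; last first.
  by move=> j _; rewrite /walk4 !eqw; ring.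
by rewrite big1 ?addr0 // => K _; rewrite big1_eq oppr0 if_same mulr0.
Qed.

Definition edge_shift (c : R) i j w w' := forall a b,
  w' a b = w a b + c *+ ((a == i) && (b == j)) - c *+ ((a == j) && (b == i)).

Lemma edge_shiftC c i j w w' : edge_shift c i j w w' -> edge_shift (- c) j i w w'.
Proof. by move=> eqw a b; rewrite eqw !mulNrn opprK addrAC. Qed.

Lemma potential_shift_oq w w' : edge_shift 1 o q w w' ->
  potential w' q = potential w q + 1.
Proof.
move=> eqw; rewrite !potential_q -(elsym_add1 pp pR _ card_T).
apply: eq_elsym => j /T_neq[jo jq]; rewrite /walk3 !eqw !eqxx.
rewrite (negbTE jo) (negbTE jq) (eq_sym q) (negbTE oq) /= ?andbF /=.
by rewrite !mulr0n mulr1n; ring.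
Qed.

Lemma potential_shift_o w w' c i : i \in T -> edge_shift c o i w w' ->
  potential w' i = potential w i.
Proof.
move=> iT eqw; have [io iq] := T_neq iT.
have qo : q != o by rewrite eq_sym.
rewrite (potential_change (w := w) (c := fun=> 0)) //.
- by rewrite big1 ?addr0 // => K _; rewrite big1_eq oppr0 if_same mulr0.
- move=> j; rewrite in_setD1 => /andP[ji /T_neq[jo jq]].
  rewrite /walk3 !eqw !eqxx (negbTE jo) (negbTE ji) (negbTE qo) (eq_sym q i) (negbTE iq).
  by rewrite ?andbF /=; ring.
- move=> j; rewrite in_setD1 => /andP[ji /T_neq[jo jq]].
  rewrite /walk4 !eqw !eqxx (negbTE jo) (negbTE ji) (negbTE qo) (eq_sym q i) (negbTE iq).
  by rewrite (negbTE io) ?andbF /=; ring.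
Qed.

Lemma potential_shift_q w w' c i : i \in T -> edge_shift c q i w w' ->
  potential w' i - potential w' q = potential w i - potential w q.
Proof.
move=> iT eqw; have [io iq] := T_neq iT.
have [qi oi] : q != i /\ o != i by rewrite !(eq_sym _ i).
have eq3 : {in T :\ i, walk3 w' =1 walk3 w}.
  move=> j; rewrite in_setD1 => /andP[ji /T_neq[jo jq]].
  rewrite /walk3 !eqw !eqxx (negbTE jq) (negbTE ji) (negbTE qi) (negbTE oq) (negbTE oi).
  by rewrite ?andbF /=; ring.
have p0 := prime_gt0 pp; have pE := prednK p0.
(* Isolating x_i in e_p leaves it as the only quantity in f q that changes. *)
rewrite !potential_q -pE !(elsymS _ _ iT) -!(eq_elsym _ eq3) pE.
rewrite (potential_change (w := w) (c := fun=> c)) //; last first.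
  move=> j; rewrite in_setD1 => /andP[ji /T_neq[jo jq]].
  rewrite /walk4 !eqw !eqxx (negbTE jq) (negbTE ji) (negbTE qi) (negbTE oq) (negbTE oi).
  by rewrite (negbTE iq) ?andbF /=; ring.
have -> : \sum_(K : {set V} | (K \subset T :\ i) && (#|K| == p.-1))
    (\prod_(j in K) walk3 w j) *
    (if i == spare K then - \sum_(j in T :\: K :\ i) c else c)
  = c * elsym (T :\ i) p.-1 (walk3 w').
  rewrite (eq_elsym _ eq3) mulr_sumr; apply: eq_bigr => K /andP[KT /eqP cK].
  rewrite mulrC; congr (_ * _); case: ifP => // _; rewrite sumr_const.
  have iTK : i \in T :\: K.
    by rewrite inE iT andbT; apply/negP => /(subsetP KT); rewrite !inE eqxx.
  (* The sum has (2p - 1) - (p - 1) - 1 = p - 1 terms, and -(p - 1) c = c, so both branches give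
     [c]. *)
  have := cardsD1 i (T :\: K).
  rewrite iTK cardsDS ?cK ?card_T; last by rewrite (subset_trans KT) ?subsetDl.
  move=> cE; have -> : #|T :\: K :\ i| = (p - 1)%N by lia.
  by rewrite mulrnBr // -mulr_natr pR mulr0 sub0r opprK.
have -> : walk3 w' i = walk3 w i + c.
  rewrite /walk3 !eqw !eqxx (negbTE qi) (negbTE oq) (negbTE oi) (negbTE iq).
  by rewrite ?andbF /=; ring.
ring.
Qed.

(** Sets [K] containing [j] drop out, as then [j] is neither r(K) nor in [T :\: K]. The remaining
    sum is invariant under exchanging [i] with [j] and [c] with [- c], whence the cancellation in
    [potential_shift_T]. *)
Lemma potential_shift_at w w' c i j : i \in T -> j \in T -> i != j ->
  edge_shift c i j w w' ->
  potential w' i = potential w i +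
  \sum_(K : {set V} | (K \subset T :\ i :\ j) && (#|K| == p.-1))
    (\prod_(k in K) walk3 w k) * (c *+ (spare K == j) - c *+ (spare K == i)).
Proof.
move=> iT jT ij eqw; have [io iq] := T_neq iT; have [jo jq] := T_neq jT.
have [[oi qi] [oj qj]] : (o != i /\ q != i) /\ (o != j /\ q != j).
  by rewrite !(eq_sym o) !(eq_sym q).
rewrite (potential_change (w := w) (c := fun k => c *+ (k == j))) //; first last.
- move=> k; rewrite in_setD1 => /andP[ki /T_neq[ko kq]].
  rewrite /walk4 !eqw eqxx (negbTE ki) (negbTE oi) (negbTE qi) (negbTE oj) (negbTE qj).
  by rewrite (negbTE ij) ?andbF /=; ring.
- move=> k _; rewrite /walk3 !eqw (negbTE oi) (negbTE qi) (negbTE oj) (negbTE qj).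
  by rewrite ?andbF /=; ring.
congr (_ + _); rewrite (bigID (fun K : {set V} => j \in K)) /= big1 ?add0r.
  apply: eq_big => [K|K /andP[/andP[KT cK] jK]].
    by rewrite (subsetD1 K _ j) andbAC.
  congr (_ * _); rewrite (eq_sym i); case: eqP => [->|_]; last by rewrite mulr0n subr0.
  rewrite (negbTE ij) sub0r (bigD1 j) /=; last first.
    by rewrite !in_setD !in_set1 eq_sym ij jK jT.
  by rewrite eqxx big1 ?addr0 // => k /andP[_ /negbTE->].
move=> K /andP[/andP[KT /eqP cK] jK]; have /andP[_ rK] := spareP iT KT cK.
have [rj|_] := eqVneq (spare K) j; first by rewrite rj jK in rK.
rewrite [X in - X]big1 ?oppr0 ?if_same ?mulr0 // => k.
by have [->|//] := eqVneq k j; rewrite !in_setD jK andbF.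
Qed.

Lemma potential_shift_T w w' c i j : i \in T -> j \in T -> i != j ->
  edge_shift c i j w w' ->
  potential w' j - potential w' i = potential w j - potential w i.
Proof.
move=> iT jT ij eqw; rewrite (potential_shift_at iT jT ij eqw).
rewrite (potential_shift_at jT iT _ (edge_shiftC eqw)) 1?eq_sym //.
rewrite !setDDl [[set j] :|: _]setUC.
under eq_bigr do rewrite !mulNrn opprK addrC.
by rewrite opprD addrACA subrr addr0.
Qed.

Lemma potential_shift w w' c i j : i != j -> [set i; j] != [set o; q] ->
  edge_shift c i j w w' ->
  potential w' j - potential w' i = potential w j - potential w i.
Proof.
have shift_o c1 k : k != o -> k != q -> edge_shift c1 o k w w' ->
    potential w' k - potential w' o = potential w k - potential w o.
  move=> ko kq eqw; rewrite !potential_o !subr0.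
  by apply: (potential_shift_o _ eqw); rewrite !inE negb_or ko kq.
have shift_q c1 k : k != o -> k != q -> edge_shift c1 q k w w' ->
    potential w' k - potential w' q = potential w k - potential w q.
  by move=> ko kq; apply: potential_shift_q; rewrite !inE negb_or ko kq.
have flip a b a' b' : b - a = b' - a' :> R -> a - b = a' - b'.
  by move=> eqab; rewrite -opprB eqab opprB.
move=> ij ijoq eqw; have eqw' := edge_shiftC eqw.
have [io|io] := eqVneq i o.
  move: ij ijoq eqw; rewrite io => oj ijoq eqw; apply: shift_o eqw.
    by rewrite eq_sym.
  by apply: contraNneq ijoq => ->.
have [iq|iq] := eqVneq i q.
  move: ij ijoq eqw; rewrite iq => qj ijoq eqw; apply: shift_q eqw.
    by apply: contraNneq ijoq => ->; rewrite setUC.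
  by rewrite eq_sym.
have [jo|jo] := eqVneq j o.
  by move: eqw'; rewrite jo => eqw'; apply: flip; apply: shift_o eqw'.
have [jq|jq] := eqVneq j q.
  by move: eqw'; rewrite jq => eqw'; apply: flip; apply: shift_q eqw'.
by apply: potential_shift_T eqw; rewrite // !inE negb_or ?io ?iq ?jo ?jq.
Qed.

End Potential.

(** * Pairing solutions with functions on the Albanese graph *)

Section AlbaneseGraph.

Variables (p : nat) (G : orgraph).
Local Notation V := (vert G).
Local Notation S := (edge G).
Local Notation cochain1 := {ffun S -> ('F_p)^o}.

Lemma boundary_pairing (f : H1 p G -> 'F_p) (b : chain1 p G) :
  \sum_x f x * boundary b x
  = \sum_(a : alb_edge p G) b a * (f (a.1 + e_ p a.2) - f a.1).
Proof.
under eq_bigr do rewrite sum_ffunE mulr_sumr.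
rewrite exchange_big; apply: eq_bigr => a _ /=.
rewrite -!(sum_delta f) -sumrB mulr_sumr; apply: eq_bigr => x _.
by rewrite !ffunE -mulrBr mulrCA.
Qed.

Lemma coboundaryE (v : V) (s : S) :
  coboundary p v s = (v == target s)%:R - (v == source s)%:R.
Proof.
have sumE (P : pred S) : (\sum_(t | P t) std_basis p t) s = (P s)%:R.
  rewrite sum_ffunE big_mkcond (bigD1 s) //= ffunE eqxx big1 ?addr0.
    by case: (P s).
  by move=> t /negbTE ts; rewrite ffunE eq_sym ts if_same.
by rewrite [LHS]ffunE [X in _ + X]ffunE !sumE ![_ == v]eq_sym.
Qed.

Lemma coboundary_B1 (v : V) : coboundary p v \in B1 p G.
Proof. by rewrite memv_span // map_f // mem_enum. Qed.

Lemma cochain1_sum (c : cochain1) : \sum_s c s *: std_basis p s = c.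
Proof.
apply/ffunP => s; rewrite sum_ffunE (bigD1 s) //= !ffunE eqxx big1 ?addr0.
  exact: mulr1.
by move=> t /negbTE ts; rewrite !ffunE eq_sym ts; apply: mulr0.
Qed.

Lemma B1_gradient (u : cochain1) : u \in B1 p G ->
  exists h : V -> 'F_p, forall s, u s = h (target s) - h (source s).
Proof.
rewrite /B1 span_def big_map big_enum => /memv_sumP[c cP ->].
have /fin_all_exists[h hP] (v : V) : exists k : 'F_p, c v = k *: coboundary p v.
  by apply/vlineP; apply: cP.
(* The potential at [v] is the coefficient of the coboundary of [v]. *)
exists h => s; rewrite sum_ffunE.
under eq_bigr do rewrite hP ffunE coboundaryE.
by rewrite -!(sum_delta h) -sumrB; apply: eq_bigr => v _; apply: mulrBr.
Qed.

Lemma solution_pairing (b : S -> chain1 p G) (f : V -> H1 p G -> 'F_p)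
    (k : S -> 'F_p) : is_solution b ->
  (forall s x, f (target s) (x + e_ p s) - f (source s) (x + e_ p s)
               = f (target s) x - f (source s) x + k s) ->
  \sum_s k s * color_profile b s = 0.
Proof.
case=> colb solb fk.
have flow v : \sum_s \sum_x
    coboundary p v s * b s (x, s) * (f v (x + e_ p s) - f v x) = 0.
  have /solb b0 :
      \sum_s (coboundary p v s : 'F_p) *: std_basis p s \in B1 p G.
    by rewrite cochain1_sum coboundary_B1.
  have := boundary_pairing (f v) (\sum_s (coboundary p v s : 'F_p) *: b s).
  rewrite b0 big1 => [|x _]; last by rewrite ffunE mulr0.
  move=> sum0; rewrite [RHS]sum0 exchange_big pair_big.
  apply: eq_bigr => -[x s] _ /=.
  congr (_ * _); apply/esym.
  (* By the color condition only [b s] has a coefficient on the edge [(x, s)]. *)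
  rewrite sum_ffunE (bigD1 s) //= big1 ?addr0 => [|t ts].
    by rewrite ffunE.
  by rewrite ffunE colb ?scaler0 //= eq_sym.
transitivity (\sum_v \sum_s \sum_x
    coboundary p v s * b s (x, s) * (f v (x + e_ p s) - f v x)); last exact: big1.
rewrite exchange_big; apply: eq_bigr => s _; rewrite exchange_big ffunE mulr_sumr.
apply: eq_bigr => x _ /=.
(* For fixed [s] and [x], only the two ends of [s] survive in the sum over [v], leaving the
   increment [k s]. *)
under eq_bigr do rewrite mulrAC [_ * (_ - _)]mulrC coboundaryE mulrBr.
rewrite -mulr_suml sumrB !(sum_delta (fun v => f v (x + e_ p s) - f v x)).
congr (_ * _); rewrite -[k s](addKr (f (target s) x - f (source s) x)) -fk.
ring.
Qed.

(** Antisymmetric extension to ordered pairs; summing over edges avoids choosing one and makes it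
    additive in [w]. *)
Definition oriented (w : cochain1) (i j : V) : 'F_p :=
  \sum_(s | (source s == i) && (target s == j)) w s
  - \sum_(s | (source s == j) && (target s == i)) w s.

Lemma orientedD u w i j : oriented (u + w) i j = oriented u i j + oriented w i j.
Proof.
rewrite /oriented addrACA -opprD -!big_split /=.
by congr (_ - _); apply: eq_bigr => s _; rewrite ffunE.
Qed.

Lemma oriented_edge_shift (w : cochain1) s :
  edge_shift 1 (source s) (target s) (oriented w) (oriented (w + std_basis p s)).
Proof.
have sumE (P : pred S) : \sum_(t | P t) std_basis p s t = (P s)%:R :> 'F_p.
  rewrite big_mkcond (bigD1 s) //= ffunE eqxx big1 ?addr0; first by case: (P s).
  by move=> t /negbTE ts; rewrite ffunE ts if_same.
move=> i j; rewrite orientedD [X in _ + X]/oriented !sumE addrA.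
by rewrite !(eq_sym i) !(eq_sym j) [(target s == i) && _]andbC.
Qed.

Lemma repr_add_e (x : H1 p G) s :
  repr (x + e_ p s) - (repr x + std_basis p s) \in B1 p G.
Proof.
rewrite Quotient.idealrBE; apply/eqP.
have := reprK (x + e_ p s); rewrite -{2}(reprK x) -raddfD; exact.
Qed.

End AlbaneseGraph.

(** * Complete graphs and the conclusion *)

Section CompleteGraph.

Variables (n : nat) (src tgt : K_edge n -> 'I_n).
Hypothesis (hor : is_K_orientation src tgt).

Lemma K_src_neq_tgt s : src s != tgt s.
Proof. have : #|val s| == 2%N := valP s.
by rewrite hor cards2; case: (src s == tgt s). Qed.

Lemma K_edge_inj s t : [set src s; tgt s] = [set src t; tgt t] -> s = t.
Proof. by rewrite -!hor => /val_inj. Qed.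

Lemma oriented_B1 p (u : {ffun K_edge n -> ('F_p)^o}) :
  u \in B1 p (oriented_K src tgt) ->
  exists h : 'I_n -> 'F_p, forall i j,
    @oriented p (oriented_K src tgt) u i j = h j - h i.
Proof.
move=> /B1_gradient[/= h uE]; exists h => i j; rewrite /oriented /=.
have [->|ij] := eqVneq i j; first by rewrite !subrr.
have ijP : #|[set i; j]| == 2%N by rewrite cards2 ij.
pose s0 : K_edge n := Sub [set i; j] ijP.
have s0P : [set src s0; tgt s0] = [set i; j] by rewrite -hor.
(* Exactly one of the two sums in [oriented] is nonempty, according to the direction of the unique
   edge [s0] joining [i] and [j]. *)
have sumE a b : a != b -> [set a; b] = [set i; j] ->
    \sum_(s | (src s == a) && (tgt s == b)) u s
    = if src s0 == a then h b - h a else 0.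
  move=> ab abE; have [sa|sa] := ifPn.
    have tb : tgt s0 == b.
      have : tgt s0 \in [set a; b] by rewrite abE -s0P !inE eqxx orbT.
      by rewrite !inE -(eqP sa) eq_sym (negbTE (K_src_neq_tgt s0)).
    rewrite (bigD1 s0) /= ?sa // big1 ?addr0; first by rewrite uE (eqP sa) (eqP tb).
    move=> s /andP[/andP[/eqP s1 /eqP s2] /eqP[]]; apply: K_edge_inj.
    by rewrite s1 s2 s0P.
  rewrite big1 // => s /andP[/eqP s1 /eqP s2].
  suff ss0 : s = s0 by rewrite -ss0 s1 eqxx in sa.
  by apply: K_edge_inj; rewrite s1 s2 s0P.
rewrite !sumE // 1?eq_sym //; last by rewrite setUC.
have : src s0 \in [set i; j] by rewrite -s0P !inE eqxx.
rewrite !inE => /orP[]/eqP->; rewrite eqxx.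
  by rewrite (negbTE ij) subr0.
by rewrite (negbTE ij) sub0r opprB.
Qed.

End CompleteGraph.

Theorem theorem1p5 (p : nat) (hp : prime p)
    (src tgt : K_edge (2 * p + 1)%N -> 'I_(2 * p + 1)%N)
    (hor : is_K_orientation src tgt)
    (b : edge (oriented_K src tgt) -> chain1 p (oriented_K src tgt))
    (hb : is_solution b) :
  color_profile b = 0.
Proof.
apply/ffunP => s0; rewrite [RHS]ffunE.
have pF : p%:R = 0 :> 'F_p by rewrite pchar_Fp_0.
have cV : #|'I_(2 * p + 1)%N| = (2 * p + 1)%N by rewrite card_ord.
pose o := src s0; pose q := tgt s0.
have oq : o != q := K_src_neq_tgt hor s0.
pose f v (x : H1 p (oriented_K src tgt)) : 'F_p :=
  potential p o q (oriented (repr x)) v.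
(* The chosen representative of x + e_s agrees with [repr x + std_basis p s] only modulo [B1], which
   the potential does not see. *)
have fD v x s :
    f v (x + e_ p s) = potential p o q (oriented (repr x + std_basis p s)) v.
  have [h hE] := oriented_B1 hor (repr_add_e x s).
  rewrite /f; apply: (potential_gauge p oq (h := h)) => i j.
  by rewrite -hE -orientedD subrKC.
(* With k the indicator of [s0], the pairing is the single entry at [s0]. *)
have := @solution_pairing p (oriented_K src tgt) b f (fun s => (s == s0)%:R) hb.
rewrite (bigD1 s0) //= eqxx mul1r big1 ?addr0 => [|s /negbTE->]; last exact: mul0r.
apply=> s x; rewrite !fD /f.
have shift_s := oriented_edge_shift (repr x) s.
have [ss0|ss0] := eqVneq s s0.
  rewrite ss0 in shift_s *.
  by rewrite (potential_shift_oq hp pF cV oq shift_s) !potential_o !subr0.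
rewrite addr0; apply: (potential_shift hp pF cV oq _ _ shift_s).
  exact: K_src_neq_tgt.
by apply: contra_neq ss0; apply: K_edge_inj.
Qed.
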